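(* $$\lim_{p/q\to\infty}\left(\frac pq-\Theta(E_{p/q})\right)=0,$$ that is: for every $\varepsilon>0$ there is a real number $C$ such that for all integers $p,q\ge 1$ with $p/q\ge C$ one has $\left|\frac pq-\Theta(E_{p/q})\right|<\varepsilon$.
   Context: For integers $p,q\ge 1$, the fraction graph $E_{p/q}$ is the graph with vertex set $\mathbb{Z}/p\mathbb{Z}$ in which two distinct vertices are adjacent if and only if their distance modulo $p$ is strictly less than $q$ (the distance modulo $p$ of $u,v$ is the minimum of $|u'-v'|$ over integer representatives $u',v'$ of $u,v$). It depends on the pair $(p,q)$, not only on the rational number $p/q$. For a graph $G$, $\alpha(G)$ is its independence number. The strong product $G\boxtimes H$ has vertex set $V(G)\times V(H)$, and two distinct vertices $(a,x),(b,y)$ are adjacent iff ($a=b$ or $\{a,b\}\in E(G)$) and ($x=y$ or $\{x,y\}\in E(H)$). $G^{\boxtimes n}$ is the strong product of $n$ copies of $G$. The Shannon capacity is $\Theta(G)=\sup_{n\ge 1}\alpha(G^{\boxtimes n})^{1/n}$. *)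

(* Defs.v *)
From HB Require Import structures.
From mathcomp Require Import all_boot all_order all_algebra.
From mathcomp Require Import boolp classical_sets reals exp.

Set Implicit Arguments.
Unset Strict Implicit.
Unset Printing Implicit Defensive.

Import Order.TTheory GRing.Theory Num.Theory.

Local Open Scope ring_scope.

Record sgraph := SGraph {
  vertex :> finType;
  edge : rel vertex;
  edge_sym : symmetric edge;
  edge_irr : irreflexive edge }.

Arguments edge {G} : rename.

Definition independent (G : sgraph) (S : {set G}) : bool :=
  [forall x in S, forall y in S, ~~ edge x y].

Definition alpha (G : sgraph) : nat :=
  (\max_(S : {set G} | independent S) #|S|)%N.

Section StrongProduct.
Variables G H : sgraph.

Definition strong_edge : rel (G * H)%type := fun u v =>
  [&& u != v, (u.1 == v.1) || edge u.1 v.1 & (u.2 == v.2) || edge u.2 v.2].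

Lemma strong_edge_sym : symmetric strong_edge.
Proof.
move=> u v; rewrite /strong_edge eq_sym (eq_sym u.1) (eq_sym u.2).
by rewrite (edge_sym u.1) (edge_sym u.2).
Qed.

Lemma strong_edge_irr : irreflexive strong_edge.
Proof. by move=> u; rewrite /strong_edge eqxx. Qed.

Definition strong_prod : sgraph := SGraph strong_edge_sym strong_edge_irr.

End StrongProduct.

Definition K1 : sgraph :=
  @SGraph unit (fun _ _ => false) (fun _ _ => erefl) (fun _ => erefl).

(* For n >= 1 this is exactly G, G * G, G * (G * G), ... with n factors;
   the one-vertex graph is only the value at n = 0. *)
Definition strong_pow (G : sgraph) (n : nat) : sgraph :=
  iterop n strong_prod G K1.

(* The set is nonempty and bounded above by the number of vertices of G, so
   the total function sup returns its actual supremum. *)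
Definition shannon_capacity (R : realType) (G : sgraph) : R :=
  sup [set (alpha (strong_pow G n))%:R `^ n%:R^-1 | n in [set n : nat | (0 < n)%N]].

Section FractionGraph.
Variables p q : nat.

(* Z/pZ is represented by 'I_p rather than 'Z_p, which has two elements when
   p = 1. *)
Definition rep_dist (u v : 'I_p) (d : nat) : Prop :=
  exists a b : int, [/\ (a = u%:Z %[mod p%:Z])%Z, (b = v%:Z %[mod p%:Z])%Z
                      & d = `|a - b|%N].

Lemma rep_dist_ex (u v : 'I_p) : exists d, `[< rep_dist u v d >].
Proof. by exists `|u%:Z - v%:Z|%N; apply/asboolP; exists u%:Z, v%:Z. Qed.

Definition mod_dist (u v : 'I_p) : nat := ex_minn (rep_dist_ex u v).

Lemma rep_distC (u v : 'I_p) d : rep_dist u v d -> rep_dist v u d.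
Proof. by move=> [a [b [ha hb ->]]]; exists b, a; rewrite distnC. Qed.

Lemma mod_distC (u v : 'I_p) : mod_dist u v = mod_dist v u.
Proof.
rewrite /mod_dist; case: ex_minnP => m /asboolP Hm m_min.
case: ex_minnP => n /asboolP Hn n_min; apply/eqP; rewrite eqn_leq.
by rewrite m_min ?n_min //; apply/asboolP/rep_distC.
Qed.

Definition fraction_edge : rel 'I_p := fun u v =>
  (u != v) && (mod_dist u v < q)%N.

Lemma fraction_edge_sym : symmetric fraction_edge.
Proof. by move=> u v; rewrite /fraction_edge eq_sym mod_distC. Qed.

Lemma fraction_edge_irr : irreflexive fraction_edge.
Proof. by move=> u; rewrite /fraction_edge eqxx. Qed.

Definition fraction_graph : sgraph :=
  SGraph fraction_edge_sym fraction_edge_irr.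

End FractionGraph.

(* Main.v *)
Require Import Defs.
From mathcomp Require Import all_boot all_order all_algebra.
From mathcomp Require Import boolp classical_sets reals exp.
From mathcomp Require Import zify ring lra.

Set Implicit Arguments.
Unset Strict Implicit.
Unset Printing Implicit Defensive.

Import Order.TTheory GRing.Theory Num.Theory.

Local Open Scope ring_scope.

(** Write E(p,q) for the fraction graph and x = p/q; only x large matters, so
    q <= p.

    Upper bound.  The q residues in a cyclic window of length q form a clique of
    E(p,q).  An independent set of E(p,q) * H restricted to a window therefore
    projects injectively onto an independent set of H, and averaging over the p
    windows gives alpha(E(p,q) * H) <= x alpha(H) ([alpha_strong_prod_le]).  So
    alpha(E(p,q)^n) <= x^n, and the capacity is at most x.

    Lower bound.  Everything rests on the no-homomorphism principle
    ([no_homomorphism]): if G maps to E(p,q) by an edge-preserving map, then the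
    preimages of the p translates of a maximum independent set of E(p,q) are
    independent in G, and on average they have density alpha(E(p,q))/p; hence
    alpha(G)/|G| >= alpha(E(p,q))/p.  Three maps feed this principle.

    - If q r <= p, then (u, w) |-> r u + w mod p is a homomorphism from
      E(p,q) * E(p,r) to E(p,qr): r e + f with |e| < q and |f| < r is a
      two-digit expansion, which vanishes only when e = f = 0.  Iterating,
      E(p,q)^d maps to E(p,q^d) ([hom_fraction_pow]).
    - Reduction mod p is a homomorphism from E(p+q,q) to E(p,q)
      ([hom_fraction_addq]).
    - If p'/q' <= p/q, then rounding u p / p' down carries E(p',q') to E(p,q) and
      preserves non-adjacency of distinct vertices, so the independence numbers of
      all powers are monotone in the fraction ([cohom_fraction]).

    For p >= q^d write p = k q^d + a + j q with a < q and a + j q < q^d, and let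
    p0 = k q^d + a.  The first two maps compose to a homomorphism
    E(p,q)^d -> E(p0,q)^d -> E(p0,q^d), whose target has independence number at
    least k.  Hence alpha(E(p,q)^d) is at least p^d k/p0.  The density k q^d/p0 is
    1 - a/p0, and a < q, p <= 2 p0, so alpha(E(p,q)^d) >= x^d (1 - 2/x).  This is
    at least (x - 4/d)^d when x >= 4: the loss of order 1 is shared by d factors.

    The bound needs p >= q^d, which is not implied by x being large.  For an
    arbitrary fraction one therefore first rounds x down to a fraction with the
    fixed denominator N, at a cost of 1/N, and then takes d = N: once x >= 4 N^N,
    the capacity is at least x - 5/N. *)

(** * Adjacency as congruence *)

Lemma small_multiple (p : nat) (x m : int) :
  x = m * p%:Z -> (`|x| < p)%N -> m = 0.
Proof.
move=> -> ltp; have [h|[h|//]] : 1 <= m \/ m <= -1 \/ m = 0 by lia.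
- by nia.
- by nia.
Qed.

(** Congruences are spelled out with an explicit multiple of p so that the
    residue computations below become integer arithmetic. *)
Lemma fraction_connP p q (u v : 'I_p) : (0 < q)%N ->
  reflect (exists e m : int,
             (`|e| < q)%N /\ u%:Z = v%:Z + e + m * p%:Z)
          ((u == v) || fraction_edge q u v).
Proof.
move=> q0; rewrite /fraction_edge orb_andr orbN /=.
have mdP : reflect (exists e m : int,
             (`|e| < q)%N /\ u%:Z = v%:Z + e + m * p%:Z) (mod_dist u v < q)%N.
  rewrite /mod_dist; case: ex_minnP => d /asboolP hd dmin.
  apply: (iffP idP) => [|[e [m [ltq huv]]]].
    case: hd => a [b [ha hb ->]] ltq.
    move/eqP: ha; rewrite eqz_mod_dvd => /dvdzP [m hm].
    move/eqP: hb; rewrite eqz_mod_dvd => /dvdzP [l hl].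
    by exists (a - b), (l - m); split=> //; lia.
  apply: leq_ltn_trans ltq; apply: dmin; apply/asboolP.
  exists (v%:Z + e), v%:Z; split=> //; last by rewrite addrC addKr.
  by apply/eqP; rewrite eqz_mod_dvd; apply/dvdzP; exists (- m); lia.
case: eqP => [->|_] /=; last exact: mdP.
by apply: ReflectT; exists 0, 0; split; lia.
Qed.

(** When q <= p, a nonzero difference smaller than q is not a multiple of p, so
    distinctness of the vertices can be read off the difference. *)
Lemma fraction_edgeP p q (u v : 'I_p) : (0 < q <= p)%N ->
  reflect (exists e m : int,
             [/\ e != 0, (`|e| < q)%N & u%:Z = v%:Z + e + m * p%:Z])
          (fraction_edge q u v).
Proof.
move=> /andP [q0 qp]; have := ltn_ord u; have := ltn_ord v => hv hu.
apply: (iffP idP) => [huv|[e [m [e0 ltq huv]]]].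
  have : (u == v) || fraction_edge q u v by rewrite huv orbT.
  case/(fraction_connP _ _ q0) => e [m [ltq E]].
  exists e, m; split=> //; apply/eqP => e0; move: huv.
  rewrite /fraction_edge => /andP [/eqP nuv _]; apply: nuv; apply: val_inj => /=.
  have m0 : m = 0 by nia.
  by rewrite m0 in E; lia.
have : (u == v) || fraction_edge q u v.
  by apply/(fraction_connP _ _ q0); exists e, m.
case/orP => // /eqP uv; move: huv; rewrite uv => huv.
have m0 : m = 0 by nia.
by rewrite m0 in huv; lia.
Qed.

Lemma fraction_edgeD p q (t u v : 'I_p.+1) : (0 < q)%N ->
  @fraction_edge p.+1 q u v -> @fraction_edge p.+1 q (u + t) (v + t).
Proof.
move=> q0 huv.
have : (u == v) || fraction_edge q u v by rewrite huv orbT.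
case/(fraction_connP _ _ q0) => e [m [ltq E]].
have : (u + t == v + t) || fraction_edge q (u + t) (v + t).
  apply/(fraction_connP _ _ q0); rewrite /=.
  have := divn_eq (u + t) p.+1; have := divn_eq (v + t) p.+1 => Ev Eu.
  exists e, (m - ((u + t) %/ p.+1)%:Z + ((v + t) %/ p.+1)%:Z); split=> //; lia.
case/orP => // /eqP /addIr uv.
by move: huv; rewrite uv fraction_edge_irr.
Qed.

(** * Homomorphisms, cohomomorphisms and strong products *)

Definition graph_hom (G H : sgraph) (f : G -> H) :=
  forall u v, edge u v -> edge (f u) (f v).

(** Contrapositively, a homomorphism between the complement graphs: distinct
    non-adjacent vertices are sent to distinct non-adjacent vertices. *)
Definition graph_cohom (G H : sgraph) (g : G -> H) :=
  forall u v, (g u == g v) || edge (g u) (g v) -> (u == v) || edge u v.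

Lemma hom_comp (G H K : sgraph) (f : G -> H) (g : H -> K) :
  graph_hom f -> graph_hom g -> graph_hom (g \o f).
Proof. by move=> hf hg u v /hf /hg. Qed.

(** The strong product is the product for the reflexive closure of adjacency. *)
Lemma strong_connE (G H : sgraph) (u v : strong_prod G H) :
  (u == v) || edge u v =
  ((u.1 == v.1) || edge u.1 v.1) && ((u.2 == v.2) || edge u.2 v.2).
Proof.
rewrite /= /strong_edge; case: (u =P v) => [->|] //=.
by rewrite !eqxx.
Qed.

Lemma hom_strong_prod (G G' H H' : sgraph) (f : G -> G') (g : H -> H') :
  graph_hom f -> graph_hom g ->
  @graph_hom (strong_prod G H) (strong_prod G' H') (fun u => (f u.1, g u.2)).
Proof.
move=> hf hg [a x] [b y]; rewrite /= /strong_edge /= !xpair_eqE.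
have neq (K : sgraph) (c d : K) : edge c d -> (c == d) = false.
  by move=> cd; apply/eqP => E; move: cd; rewrite E edge_irr.
case: (a =P b) => [->|_]; case: (x =P y) => [->|_] //=; rewrite ?eqxx ?andbF //=.
- by move=> /hg h; rewrite h (neq _ _ _ h) orbT.
- by rewrite !andbT => /hf h; rewrite h (neq _ _ _ h).
- by move=> /andP [/hf h1 /hg h2]; rewrite h1 h2 (neq _ _ _ h1) !orbT.
Qed.

Lemma cohom_strong_prod (G G' H H' : sgraph) (f : G -> G') (g : H -> H') :
  graph_cohom f -> graph_cohom g ->
  @graph_cohom (strong_prod G H) (strong_prod G' H') (fun u => (f u.1, g u.2)).
Proof.
by move=> hf hg u v; rewrite !strong_connE /= => /andP [/hf -> /hg ->].
Qed.

Lemma hom_strong_pow (G H : sgraph) (f : G -> H) n :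
  graph_hom f -> exists F : strong_pow G n -> strong_pow H n, graph_hom F.
Proof.
move=> hf; case: n => [|n]; first by exists id.
elim: n => [|n [F hF]]; first by exists f.
exists (fun u : strong_prod G (strong_pow G n.+1) => (f u.1, F u.2)).
exact: hom_strong_prod.
Qed.

Lemma cohom_strong_pow (G H : sgraph) (f : G -> H) n :
  graph_cohom f -> exists F : strong_pow G n -> strong_pow H n, graph_cohom F.
Proof.
move=> hf; case: n => [|n]; first by exists id.
elim: n => [|n [F hF]]; first by exists f.
exists (fun u : strong_prod G (strong_pow G n.+1) => (f u.1, F u.2)).
exact: cohom_strong_prod.
Qed.

Lemma card_strong_pow (G : sgraph) n : #|strong_pow G n| = (#|G| ^ n)%N.
Proof.
case: n => [|n]; first by rewrite card_unit.
elim: n => [|n IH]; first by rewrite expn1.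
by rewrite expnS -IH; exact: card_prod.
Qed.

(** * Independence numbers *)

Lemma independentP (G : sgraph) (S : {set G}) :
  reflect {in S &, forall u v, ~~ edge u v} (independent S).
Proof.
apply: (iffP forall_inP) => [h u v uS vS|h u uS].
  by have /forall_inP := h _ uS; apply.
by apply/forall_inP => v vS; apply: h.
Qed.

Lemma leq_alpha (G : sgraph) (S : {set G}) : independent S -> (#|S| <= alpha G)%N.
Proof. by move=> hS; rewrite /alpha (bigD1 S) //= leq_maxl. Qed.

Lemma alpha_witness (G : sgraph) : {S : {set G} | independent S & #|S| = alpha G}.
Proof.
have h0 : independent (finset.set0 : {set G}).
  by apply/independentP => u v; rewrite inE.
have := @eq_bigmax_cond _ [pred S : {set G} | independent S] (fun S => #|S|).
rewrite -/(alpha G); case; first by apply/card_gt0P; exists finset.set0.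
by move=> S hS E; exists S.
Qed.

Lemma alpha_cohom (G H : sgraph) (f : G -> H) :
  graph_cohom f -> (alpha G <= alpha H)%N.
Proof.
move=> hf; have [S /independentP hS <-] := alpha_witness G.
have inj : {in S &, injective f}.
  move=> u v uS vS E; have := hf u v; rewrite E eqxx (negPf (hS _ _ uS vS)) orbF.
  by move=> /(_ isT)/eqP.
rewrite -(card_in_imset inj); apply/leq_alpha/independentP.
move=> _ _ /imsetP [u uS ->] /imsetP [v vS ->]; apply/negP => E.
have := hf u v; rewrite E orbT (negPf (hS _ _ uS vS)) orbF => /(_ isT)/eqP uv.
by move: E; rewrite uv edge_irr.
Qed.

(** Double counting of the pairs (x, t) such that f x + t lies in a fixed maximum
    independent set A: translations are automorphisms of the target, so each t
    contributes at most alpha G, while each x contributes exactly #|A|. *)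
Lemma no_homomorphism (G : sgraph) p q (f : G -> fraction_graph p q) :
  (0 < q)%N -> graph_hom f ->
  (alpha (fraction_graph p q) * #|G| <= p * alpha G)%N.
Proof.
case: p f => [|p] f q0 hf.
  rewrite mul0n; suff -> : #|G| = 0%N by rewrite muln0.
  by apply: eq_card0 => x; case: (f x).
have [A /independentP hA <-] := alpha_witness (fraction_graph p.+1 q).
pose S (t : 'I_p.+1) : {set G} := [set x | (f x : 'I_p.+1) + t \in A].
have hS t : independent (S t).
  apply/independentP => x y; rewrite !inE => xA yA; apply/negP => /hf xy.
  by have /negP := hA _ _ xA yA; apply; apply: fraction_edgeD.
have <- : (\sum_t #|S t| = #|A| * #|G|)%N.
  under eq_bigr do rewrite -sum1_card big_mkcond.
  rewrite exchange_big /= mulnC -sum_nat_const; apply: eq_bigr => x _.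
  rewrite -big_mkcond -(card_preimset A (@addrI _ (f x : 'I_p.+1))) -sum1_card.
  by apply: eq_bigl => t; rewrite !inE.
have <- : (\sum_(t < p.+1) alpha G = p.+1 * alpha G)%N.
  by rewrite sum_nat_const card_ord.
by apply: leq_sum => t _; apply: leq_alpha.
Qed.

(** The multiples 0, q, ..., (p %/ q - 1) q leave a gap of at least q when they
    wrap around. *)
Lemma leq_divn_alpha p q : (0 < q)%N -> (p %/ q <= alpha (fraction_graph p q))%N.
Proof.
move=> q0; case: p => [|p]; first by rewrite div0n.
have hle (j : 'I_(p.+1 %/ q)) : (q * j + q <= p.+1)%N.
  by rewrite addnC -mulnS mulnC -leq_divRL.
have hlt (j : 'I_(p.+1 %/ q)) : (q * j < p.+1)%N by have := hle j; lia.
pose c (j : 'I_(p.+1 %/ q)) : fraction_graph p.+1 q :=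
  (inord (q * j) : 'I_p.+1).
have cE (j : 'I_(p.+1 %/ q)) : nat_of_ord (c j) = (q * j)%N.
  by rewrite inordK.
have cinj : injective c.
  move=> i j /(congr1 (@nat_of_ord _)); rewrite !cE => /eqP.
  by rewrite eqn_pmul2l // => /eqP /val_inj.
rewrite -[X in (X <= _)%N]card_ord -cardsT -(card_imset _ cinj).
apply/leq_alpha/independentP => _ _ /imsetP [i _ ->] /imsetP [j _ ->].
have hi := hle i; have hj := hle j.
apply/negP => /fraction_edgeP; rewrite q0 => /(_ ltac:(lia)) [e [m []]].
rewrite !cE => e0 ltq E.
have m0 : m = 0.
  by apply: (@small_multiple p.+1 ((q * i)%N%:Z - (q * j)%N%:Z - e)); lia.
have ee : e = (i%:Z - j%:Z) * q%:Z by rewrite m0 in E; lia.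
by move: e0; rewrite ee (small_multiple ee ltq) mul0r.
Qed.

(** * Upper bound by cyclic windows *)

Lemma card_ltn_ord p q : (q <= p)%N -> #|[set s : 'I_p | (s < q)%N]| = q.
Proof.
move=> qp; rewrite -sum1_card; under eq_bigl do rewrite inE.
by rewrite (big_ord_narrow qp) sum1_card card_ord.
Qed.

(** Each of the p windows of length q is a clique, so the part [W t] of an
    independent set above the window starting at t projects injectively onto an
    independent set of H; each vertex lies above exactly q windows. *)
Lemma alpha_strong_prod_le (H : sgraph) p q : (0 < q <= p)%N ->
  (alpha (strong_prod (fraction_graph p q) H) * q <= p * alpha H)%N.
Proof.
case: p => [|p] /andP [q0 qp]; first by lia.
set K := strong_prod _ _.
have [S /independentP hS <-] := alpha_witness K.
pose W (t : 'I_p.+1) : {set K} := [set x in S | (((x.1 : 'I_p.+1) - t)%R < q)%N].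
have hW t x y : x \in W t -> y \in W t ->
    (x.2 == y.2) || edge x.2 y.2 -> x = y.
  rewrite !inE => /andP [xS xt] /andP [yS yt] bxy.
  have axy : (x.1 == y.1) || edge x.1 y.1.
    apply/(fraction_connP _ _ q0).
    pose c : 'I_p.+1 := (x.1 : 'I_p.+1) - t.
    pose d : 'I_p.+1 := (y.1 : 'I_p.+1) - t.
    have ct : (c < q)%N := xt.
    have dt : (d < q)%N := yt.
    have Ex : ((c + t) %% p.+1)%N = x.1 := congr1 (@nat_of_ord _) (subrK t _).
    have Ey : ((d + t) %% p.+1)%N = y.1 := congr1 (@nat_of_ord _) (subrK t _).
    have := divn_eq (c + t) p.+1; have := divn_eq (d + t) p.+1.
    rewrite Ex Ey => Fy Fx.
    exists (c%:Z - d%:Z), (((d + t) %/ p.+1)%:Z - ((c + t) %/ p.+1)%:Z).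
    by split; lia.
  have := strong_connE x y; rewrite axy bxy (negPf (hS _ _ xS yS)) orbF.
  by move/eqP.
have leW t : (#|W t| <= alpha H)%N.
  have inj : {in W t &, injective (fun x : K => x.2)}.
    by move=> x y xW yW /= E; apply: (hW t) => //; rewrite E eqxx.
  rewrite -(card_in_imset inj); apply/leq_alpha/independentP.
  move=> _ _ /imsetP [x xW ->] /imsetP [y yW ->]; apply/negP => E.
  have xy : x = y by apply: (hW t) => //; rewrite E orbT.
  by move: E; rewrite xy edge_irr.
have <- : (\sum_t #|W t| = #|S| * q)%N.
  under eq_bigr do rewrite -sum1_card big_mkcond.
  rewrite exchange_big /= -sum_nat_const [RHS]big_mkcond; apply: eq_bigr => x _.
  rewrite -big_mkcond /=; case: ifP => xS; last first.
    by rewrite big1 // => t; rewrite inE xS.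
  have inj : injective (fun t : 'I_p.+1 => (x.1 : 'I_p.+1) - t).
    by move=> t t' /addrI /oppr_inj.
  rewrite -[RHS](card_ltn_ord qp) -(card_preimset _ inj) -sum1_card.
  by apply: eq_bigl => t; rewrite !inE xS.
have <- : (\sum_(t < p.+1) alpha H = p.+1 * alpha H)%N.
  by rewrite sum_nat_const card_ord.
by apply: leq_sum => t _.
Qed.

Lemma alpha_K1 : (alpha K1 <= 1)%N.
Proof.
rewrite -[X in (_ <= X)%N]card_unit.
by apply/bigmax_leqP => S _; apply: max_card.
Qed.

Lemma cohom_strong_prod_K1 (G : sgraph) :
  @graph_cohom G (strong_prod G K1) (fun u => (u, tt)).
Proof. by move=> u v; rewrite strong_connE andbT. Qed.

Lemma alpha_strong_pow_le p q n : (0 < q <= p)%N ->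
  (alpha (strong_pow (fraction_graph p q) n) * q ^ n <= p ^ n)%N.
Proof.
move=> hqp; case: n => [|n]; first by rewrite muln1 alpha_K1.
elim: n => [|n IH].
  (* the first power is the graph itself, with no strong product in it *)
  rewrite !expn1; have h1 := alpha_cohom (@cohom_strong_prod_K1 (fraction_graph p q)).
  apply: leq_trans (leq_mul h1 (leqnn q)) _.
  apply: leq_trans (alpha_strong_prod_le K1 hqp) _.
  by rewrite -[X in (_ <= X)%N]muln1 leq_mul2l alpha_K1 orbT.
have h := alpha_strong_prod_le (strong_pow (fraction_graph p q) n.+1) hqp.
rewrite expnS mulnA; apply: leq_trans (leq_mul h (leqnn _)) _.
by rewrite -mulnA [(p ^ _)%N]expnS leq_mul2l IH orbT.
Qed.

(** * Homomorphisms between fraction graphs *)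

Lemma hom_fraction_mul p q r : (0 < q)%N -> (0 < r)%N -> (q * r <= p)%N ->
  exists f : strong_prod (fraction_graph p q) (fraction_graph p r) ->
             fraction_graph p (q * r), graph_hom f.
Proof.
case: p => [|p] q0 r0 qrp; first by nia.
exists (fun u =>
  (inord ((r * (u.1 : 'I_p.+1) + (u.2 : 'I_p.+1)) %% p.+1) : 'I_p.+1)).
move=> u v huv; have := strong_connE u v; rewrite huv orbT => /esym /andP [].
case/(fraction_connP _ _ q0) => e1 [m1 [lt1 E1]].
case/(fraction_connP _ _ r0) => e2 [m2 [lt2 E2]].
apply/fraction_edgeP; first by rewrite muln_gt0 q0 r0.
rewrite !inordK ?ltn_pmod //.
set x := (r * _ + _)%N; set y := (r * _ + _)%N.
have := divn_eq x p.+1; have := divn_eq y p.+1 => Ey Ex.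
exists (r%:Z * e1 + e2).
exists (r%:Z * m1 + m2 - (x %/ p.+1)%:Z + (y %/ p.+1)%:Z); split.
(* the digits e1 and e2 must both vanish, which makes the edge a loop *)
- apply/eqP => E0.
  have e10 : - e1 = 0 by apply: (@small_multiple r e2); lia.
  have e20 : e2 = 0 by nia.
  have eqs (a b : 'I_p.+1) m : a%:Z = b%:Z + 0 + m * p.+1%:Z -> a = b.
    have := ltn_ord a; have := ltn_ord b => hb ha E; apply: val_inj => /=.
    have m0 : m = 0 by apply: (@small_multiple p.+1 (a%:Z - b%:Z)); lia.
    by rewrite m0 in E; lia.
  have u1 : u.1 = v.1 by apply: (eqs _ _ m1); lia.
  have u2 : u.2 = v.2 by apply: (eqs _ _ m2); lia.
  by move: huv; rewrite [u]surjective_pairing u1 u2 -surjective_pairing edge_irr.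
- by nia.
- have rE : r%:Z * (u.1 : 'I_p.+1)%:Z =
      r%:Z * (v.1 : 'I_p.+1)%:Z + r%:Z * e1 + r%:Z * m1 * p.+1%:Z.
    by rewrite E1; ring.
  have Xx : x%:Z = r%:Z * (u.1 : 'I_p.+1)%:Z + (u.2 : 'I_p.+1)%:Z.
    by rewrite /x PoszD PoszM.
  have Yy : y%:Z = r%:Z * (v.1 : 'I_p.+1)%:Z + (v.2 : 'I_p.+1)%:Z.
    by rewrite /y PoszD PoszM.
  by lia.
Qed.

Lemma hom_fraction_pow p q n : (0 < q)%N -> (q ^ n.+1 <= p)%N ->
  exists f : strong_pow (fraction_graph p q) n.+1 -> fraction_graph p (q ^ n.+1),
    graph_hom f.
Proof.
move=> q0; elim: n => [|n IH] hp; first by rewrite expn1; exists id.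
have qn0 : (0 < q ^ n.+1)%N by rewrite expn_gt0 q0.
rewrite expnS in hp *.
have [f hf] := IH (leq_trans (leq_pmull _ q0) hp).
have [g hg] := hom_fraction_mul q0 qn0 hp.
have hid : graph_hom (id : fraction_graph p q -> _) by [].
exists (g \o (fun u : strong_prod (fraction_graph p q)
                       (strong_pow (fraction_graph p q) n.+1) => (id u.1, f u.2))).
exact: hom_comp (hom_strong_prod hid hf) hg.
Qed.

(** Over Z/(p+q), an edge that wraps around joins integers that differ by p + r
    with 0 < r < q, and these reduce to residues at distance r mod p. *)
Lemma hom_fraction_addq p q : (0 < q <= p)%N ->
  exists f : fraction_graph (p + q) q -> fraction_graph p q, graph_hom f.
Proof.
case: p => [|p] /andP [q0 qp]; first by lia.
exists (fun u : 'I_(p.+1 + q) => (inord (u %% p.+1) : 'I_p.+1)) => u v.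
case/fraction_edgeP; first by rewrite q0 leq_addl.
move=> e [m [e0 ltq E]]; apply/fraction_edgeP; first by rewrite q0.
rewrite !inordK ?ltn_pmod //.
have hu := ltn_ord u; have hv := ltn_ord v.
have := divn_eq u p.+1; have := divn_eq v p.+1 => Ev Eu.
exists (e + m * q%:Z), (m - (u %/ p.+1)%:Z + (v %/ p.+1)%:Z).
have [hm|[hm|hm]] : m = 0 \/ m = 1 \/ m = -1 by nia.
all: rewrite hm in E *; split; lia.
Qed.

Lemma hom_fraction_addM p q j : (0 < q <= p)%N ->
  exists f : fraction_graph (p + j * q) q -> fraction_graph p q, graph_hom f.
Proof.
move=> /andP [q0 qp]; elim: j => [|j [f hf]]; first by rewrite addn0; exists id.
have [|g hg] := @hom_fraction_addq (p + j * q) q.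
  by rewrite q0 (leq_trans qp) ?leq_addr.
by rewrite mulSn [(q + _)%N]addnC addnA; exists (f \o g); apply: hom_comp.
Qed.

(** * Monotonicity in the fraction *)

(** The witness rounds u p / p' down.  If u - v is at least q' modulo p', then
    u p / p' exceeds v p / p' by at least q' p / p' >= q modulo p; since q is an
    integer, rounding preserves this gap. *)
Lemma cohom_fraction p q p' q' : (0 < p)%N -> (0 < q)%N -> (0 < q')%N ->
  (p' * q <= p * q')%N ->
  exists g : fraction_graph p' q' -> fraction_graph p q, graph_cohom g.
Proof.
case: p p' => [//|p] [|p'] _ q0 q'0 hpq.
  by exists (fun=> ord0) => -[].
exists (fun u : 'I_p'.+1 => (inord (u * p.+1 %/ p'.+1) : 'I_p.+1)) => u v.
have lt (w : 'I_p'.+1) : (w * p.+1 %/ p'.+1 < p.+1)%N.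
  by rewrite ltn_divLR // mulnC ltn_pmul2l.
case/(fraction_connP _ _ q0) => e [m [ltq]]; rewrite !inordK // => E.
apply/(fraction_connP _ _ q'0).
exists (u%:Z - v%:Z - m * p'.+1%:Z), m; split; last by lia.
have := divn_eq (u * p.+1) p'.+1; have := divn_eq (v * p.+1) p'.+1.
have := ltn_pmod (u * p.+1) (ltn0Sn p'); have := ltn_pmod (v * p.+1) (ltn0Sn p').
move: E; set a := (_ %/ _)%N; set b := (_ %/ _)%N.
set c := (_ %% _)%N; set d := (_ %% _)%N.
move: (nat_of_ord u) (nat_of_ord v) a b c d => {}u {}v a b c d E hc hd Ev Eu.
have he : `|e| * p'.+1%:Z + p'.+1%:Z <= p.+1%:Z * q'%:Z by nia.
have aE : a%:Z * p'.+1%:Z =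
    b%:Z * p'.+1%:Z + e * p'.+1%:Z + m * p.+1%:Z * p'.+1%:Z.
  by rewrite E; ring.
have h : `|(u%:Z - v%:Z - m * p'.+1%:Z) * p.+1%:Z| < p.+1%:Z * q'%:Z by nia.
nia.
Qed.

Lemma alpha_strong_pow_fraction_le p q p' q' n :
  (0 < p)%N -> (0 < q)%N -> (0 < q')%N -> (p' * q <= p * q')%N ->
  (alpha (strong_pow (fraction_graph p' q') n) <=
     alpha (strong_pow (fraction_graph p q) n))%N.
Proof.
move=> p0 q0 q'0 h; have [g hg] := cohom_fraction p0 q0 q'0 h.
by have [F hF] := cohom_strong_pow n hg; apply: alpha_cohom hF.
Qed.

(** * Dense independent sets in powers *)

(** The loss 2q/p comes from discarding the remainder a < q in p0 = k q^d + a,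
    which costs a relative a/p0, and from p <= 2 p0; the multiples of q between
    p0 and p are absorbed by a homomorphism without loss of density. *)
Lemma alpha_strong_pow_ge p q n : (0 < q)%N -> (q ^ n.+1 <= p)%N ->
  ((p - q.*2) * p ^ n.+1 <=
     p * q ^ n.+1 * alpha (strong_pow (fraction_graph p q) n.+1))%N.
Proof.
move=> q0 hp; set al := alpha _.
have q1 : (q <= q ^ n.+1)%N by rewrite -[X in (X <= _)%N]expn1 leq_pexp2l.
have := divn_eq p (q ^ n.+1); set k := (p %/ _)%N; set r := (p %% _)%N => Ep.
have := divn_eq r q; set j := (r %/ q)%N; set a := (r %% q)%N => Er.
have k0 : (0 < k)%N by rewrite divn_gt0 // expn_gt0 q0.
have ltr : (r < q ^ n.+1)%N by rewrite ltn_pmod // expn_gt0 q0.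
have lta : (a < q)%N by rewrite ltn_pmod.
pose p0 := (k * q ^ n.+1 + a)%N.
have p0E : p = (p0 + j * q)%N by rewrite /p0; lia.
have lep0 : (q ^ n.+1 <= p0)%N by rewrite /p0; nia.
have key : (k * p ^ n.+1 <= p0 * al)%N.
  have [|f hf] := @hom_fraction_addM p0 q j; first by rewrite q0 (leq_trans q1).
  have [F hF] := hom_strong_pow n.+1 hf.
  have [g hg] := hom_fraction_pow q0 lep0.
  have := no_homomorphism _ (hom_comp hF hg).
  rewrite -p0E card_strong_pow card_ord expn_gt0 q0 => /(_ isT).
  apply: leq_trans; rewrite leq_mul2r; apply/orP; right.
  apply: leq_trans (leq_divn_alpha p0 _); last by rewrite expn_gt0 q0.
  by rewrite leq_divRL ?expn_gt0 ?q0 // leq_addr.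
have p0_gt0 : (0 < p0)%N by rewrite (leq_trans _ lep0) // expn_gt0 q0.
have lep : (p <= p0.*2)%N by rewrite -addnn p0E leq_add2l; lia.
have dens : ((p - q.*2) * p0 <= p * (k * q ^ n.+1))%N.
  have h := leq_mul (ltnW lta) lep.
  rewrite mulnBl {1}/p0 mulnDr leq_subLR addnC leq_add2r.
  by rewrite [(p * a)%N]mulnC -doubleMl doubleMr.
rewrite -(leq_pmul2l p0_gt0) mulnA [(p0 * (p - _))%N]mulnC.
apply: leq_trans (leq_mul dens (leqnn _)) _.
have -> : (p * (k * q ^ n.+1) * p ^ n.+1 = p * q ^ n.+1 * (k * p ^ n.+1))%N by ring.
have -> : (p0 * (p * q ^ n.+1 * al) = p * q ^ n.+1 * (p0 * al))%N by ring.
exact: leq_mul.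
Qed.

(** * The capacity *)

Lemma expr1B_le (R : realFieldType) (z : R) n :
  0 <= z -> n%:R * z <= 1 -> (1 - z) ^+ n <= 1 - n%:R * z / 2.
Proof.
move=> z0; elim: n => [|n IH] hn; first by rewrite expr0 mul0r mul0r subr0.
move: hn; rewrite -natr1 mulrDl mul1r => hn.
have n0 : 0 <= n%:R * z by rewrite mulr_ge0.
have {}IH := IH ltac:(lra).
rewrite exprS; apply: le_trans (_ : (1 - z) * (1 - n%:R * z / 2) <= _).
  by rewrite ler_wpM2l //; lra.
move: IH hn n0; set y := n%:R * z => IH hn n0.
nra.
Qed.

Lemma alpha_root_le (R : realType) p q n : (0 < q <= p)%N -> (0 < n)%N ->
  (alpha (strong_pow (fraction_graph p q) n))%:R `^ n%:R^-1 <= p%:R / q%:R :> R.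
Proof.
move=> hqp n0; case/andP: (hqp) => q0 qp.
have q0R : 0 < q%:R :> R by rewrite ltr0n.
have x0 : 0 <= p%:R / q%:R :> R by rewrite divr_ge0.
have -> : p%:R / q%:R = ((p%:R / q%:R) ^+ n) `^ n%:R^-1 :> R.
  by rewrite -powR_mulrn // -powRrM divff ?powRr1 // pnatr_eq0 -lt0n.
apply: ge0_ler_powR; rewrite ?nnegrE ?invr_ge0 ?exprn_ge0 ?ler0n //.
rewrite expr_div_n ler_pdivlMr ?exprn_gt0 // -!natrX -natrM ler_nat.
exact: alpha_strong_pow_le.
Qed.

Lemma shannon_capacity_le (R : realType) p q : (0 < q <= p)%N ->
  shannon_capacity R (fraction_graph p q) <= p%:R / q%:R.
Proof.
move=> hqp; apply: ge_sup.
  by exists ((alpha (strong_pow (fraction_graph p q) 1))%:R `^ 1%:R^-1); exists 1%N.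
by move=> _ [n /= n0 <-]; apply: alpha_root_le.
Qed.

Lemma shannon_capacity_ge (R : realType) p q n (y : R) :
  (0 < q <= p)%N -> 0 <= y ->
  y ^+ n.+1 <= (alpha (strong_pow (fraction_graph p q) n.+1))%:R ->
  y <= shannon_capacity R (fraction_graph p q).
Proof.
move=> hqp y0 hy.
set al := alpha _ in hy *; apply: (@le_trans _ _ (al%:R `^ n.+1%:R^-1)).
  have -> : y = (y ^+ n.+1) `^ n.+1%:R^-1.
    by rewrite -powR_mulrn // -powRrM divff ?powRr1 // pnatr_eq0.
  by apply: ge0_ler_powR; rewrite ?nnegrE ?invr_ge0 ?exprn_ge0 ?ler0n.
apply: ub_le_sup; last by exists n.+1.
by exists (p%:R / q%:R) => _ [m /= m0 <-]; apply: alpha_root_le.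
Qed.

Lemma alpha_strong_pow_root_ge (R : realType) p q n (d := n.+1) :
  (0 < q)%N -> (4 * q ^ d <= p)%N ->
  let x : R := p%:R / q%:R in
  0 <= x - 4 / d%:R /\
  (x - 4 / d%:R) ^+ d <= (alpha (strong_pow (fraction_graph p q) d))%:R.
Proof.
move=> q0 hp x.
have q1 : (q <= q ^ d)%N by rewrite -[X in (X <= _)%N]expn1 leq_pexp2l.
have p0 : (0 < p)%N by lia.
have q0R : 0 < q%:R :> R by rewrite ltr0n.
have d0R : 0 < d%:R :> R by rewrite ltr0n.
have d1R : 1 <= d%:R :> R by rewrite ler1n.
have p0R : 0 < p%:R :> R by rewrite ltr0n.
have x4 : 4 <= x by rewrite ler_pdivlMr // -natrM ler_nat; lia.
have x0 : 0 < x by lra.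
(* chosen so that x (1 - z) = x - 4/d and 1 - d z / 2 = 1 - 2/x *)
set z : R := 4 / (d%:R * x).
have dzE : d%:R * z = 4 / x by rewrite /z; field; rewrite !lt0r_neq0.
have z0 : 0 <= z by rewrite divr_ge0 // mulr_ge0 // ltW.
have dz1 : d%:R * z <= 1 by rewrite dzE ler_pdivrMr // mul1r.
have z1 : z <= 1 by apply: le_trans dz1; rewrite ler_peMl.
have yE : x - 4 / d%:R = x * (1 - z) by rewrite /z; field; rewrite !lt0r_neq0.
split; first by rewrite yE mulr_ge0 ?subr_ge0 // ltW.
rewrite yE exprMn.
apply: le_trans (ler_wpM2l (exprn_ge0 _ (ltW x0)) (expr1B_le z0 dz1)) _.
have -> : x ^+ d * (1 - d%:R * z / 2) =
          ((p - q.*2) * p ^ d)%N%:R / (p * q ^ d)%N%:R :> R.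
  rewrite dzE /x !natrM !natrX natrB -?muln2 ?natrM; last by lia.
  rewrite expr_div_n; field.
  by rewrite ?expf_neq0 ?lt0r_neq0.
rewrite ler_pdivrMr; last by rewrite ltr0n muln_gt0 p0 expn_gt0 q0.
rewrite -natrM ler_nat [X in (_ <= X)%N]mulnC.
by apply: alpha_strong_pow_ge => //; rewrite (leq_trans _ hp) // leq_pmull.
Qed.

(** Of the loss 5/N, one part is the cost of rounding p/q down to denominator N,
    the other four that of taking the N-th power of the rounded graph. *)
Lemma shannon_capacity_fraction_ge (R : realType) p q n (N := n.+1) :
  (0 < q)%N -> (4 * N ^ N * q <= p)%N ->
  p%:R / q%:R - 5 / N%:R <= shannon_capacity R (fraction_graph p q).
Proof.
move=> q0 hp; set p1 := (p * N %/ q)%N.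
have M0 : (0 < N ^ N)%N by rewrite expn_gt0.
have qp : (q <= p)%N by rewrite (leq_trans _ hp) // leq_pmull // muln_gt0 M0.
have p0 : (0 < p)%N := leq_trans q0 qp.
have hp1 : (4 * N ^ N <= p1)%N.
  by rewrite leq_divRL // (leq_trans hp) // leq_pmulr.
have [y0 hy] := alpha_strong_pow_root_ge R (ltn0Sn n) hp1.
apply: le_trans (shannon_capacity_ge (n := n) _ y0 _); last 2 first.
- by rewrite q0.
- apply: le_trans hy _; rewrite ler_nat; apply: alpha_strong_pow_fraction_le => //.
  exact: leq_divM.
have q0R : 0 < q%:R :> R by rewrite ltr0n.
have N0R : 0 < N%:R :> R by rewrite ltr0n.
have : p%:R / q%:R <= (p1%:R + 1) / N%:R :> R.
  rewrite ler_pdivlMr // mulrAC ler_pdivrMr // natr1 -!natrM ler_nat.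
  by rewrite ltnW // ltn_ceil.
by rewrite mulrDl; move: (N%:R^-1) => i; lra.
Qed.

Theorem theorem1p2 (R : realType) (eps : R) (heps : 0 < eps) :
  exists C : R, forall p q : nat, (0 < p)%N -> (0 < q)%N ->
    C <= p%:R / q%:R ->
    `| p%:R / q%:R - shannon_capacity R (fraction_graph p q) | < eps.
Proof.
pose n := Num.truncn (5 / eps); pose N := n.+1.
have ltN : 5 / N%:R < eps.
  rewrite ltr_pdivrMr ?ltr0n // mulrC -ltr_pdivrMr //.
  by have /andP [] := truncn_itv (ltW (divr_gt0 (ltr0Sn R 4) heps)).
exists (4 * N ^ N)%N%:R => p q p0 q0.
rewrite ler_pdivlMr ?ltr0n // -natrM ler_nat => hp.
have qp : (0 < q <= p)%N.
  by rewrite q0 (leq_trans _ hp) // leq_pmull // muln_gt0 expn_gt0.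
have hi := shannon_capacity_le R qp.
have lo := shannon_capacity_fraction_ge R q0 hp.
rewrite ger0_norm ?subr_ge0 //.
by apply: le_lt_trans ltN; move: lo; rewrite -/N; move: (N%:R^-1) => i; lra.
Qed.
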